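(* There is a constant $c>0$ and a family of triangle-free critical graphs which, for every $k\geq 4$, contains infinitely many $k$-chromatic graphs, each member on $n$ vertices having more than $cn^2$ edges. In particular, the density constants satisfy $c_{3,4}\geq \frac{1}{16}$, $c_{3,5}\geq \frac{4}{31}$, and $c_{3,k}=\frac14$ for all $k\geq 6$.
   Context: A graph is $k$-critical if it has chromatic number $k$ and removing any edge allows it to be properly $(k-1)$-colored; a graph is critical if it is $k$-critical for some $k$. The odd-girth of a graph is the length of a shortest odd cycle (so ''odd-girth $>3$'' means triangle-free). For integers $\ell\geq 3$, $k\geq 4$, the density constant $c_{\ell,k}$ is the supremum of the constants $c$ such that there are infinitely many $k$-critical graphs of odd-girth $>\ell$, each having more than $cn^2$ edges, where $n$ is its number of vertices. *)

(* Defs.v *)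
From HB Require Import structures.
From mathcomp Require Import all_boot all_order all_algebra.
From mathcomp Require Import boolp classical_sets reals.
Unset Printing Implicit Defensive.
Import Order.TTheory GRing.Theory Num.Theory.

Record graph := Graph {
  gn : nat;
  gadj : rel 'I_gn;
  gadj_sym : symmetric gadj;
  gadj_irr : irreflexive gadj }.

Definition nedges (G : graph) : nat :=
  #|[set p : 'I_(gn G) * 'I_(gn G) | (p.1 < p.2)%N && gadj G p.1 p.2]|.

Definition colorable {n : nat} (e : rel 'I_n) (k : nat) : Prop :=
  exists f : 'I_n -> 'I_k, forall x y, e x y -> f x != f y.

Definition chromatic_eq (G : graph) (k : nat) : Prop :=
  colorable (gadj G) k /\ forall j, (j < k)%N -> ~ colorable (gadj G) j.

Definition remove_edge {n : nat} (e : rel 'I_n) (x y : 'I_n) : rel 'I_n :=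
  fun u v => e u v && ~~ (((u == x) && (v == y)) || ((u == y) && (v == x))).

Definition k_critical (k : nat) (G : graph) : Prop :=
  chromatic_eq G k /\
  forall x y, gadj G x y -> colorable (remove_edge (gadj G) x y) k.-1.

Definition critical (G : graph) : Prop := exists k, k_critical k G.

Definition has_cycle (G : graph) (m : nat) : Prop :=
  (3 <= m)%N /\
  exists f : 'I_m -> 'I_(gn G),
    injective f /\ forall i : 'I_m, gadj G (f i) (f (ordS i)).

Definition odd_girth_gt (l : nat) (G : graph) : Prop :=
  forall m, odd m -> (m <= l)%N -> ~ has_cycle G m.

Definition triangle_free (G : graph) : Prop := odd_girth_gt 3 G.

(* density constant c_{l,k}: supremum of the c such that there are infinitely
   many k-critical graphs of odd-girth > l with more than c n^2 edges
   ("infinitely many" = of unbounded order). *)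
Definition density_set (R : realType) (l k : nat) : set R :=
  [set c : R | forall N : nat, exists G : graph,
     (N <= gn G)%N /\ k_critical k G /\ odd_girth_gt l G /\
     (c * ((gn G)%:R ^+ 2) < (nedges G)%:R)%R]%classic.

Definition density_const (R : realType) (l k : nat) : R :=
  sup (density_set R l k).

(* Main.v *)
(* The construction is Toft's, with Zykov's product in place of the matchings.
   Fix K colours and triangle-free critical graphs G_1, ..., G_q of chromatic
   numbers K, K - 1, ..., K - q + 1, and join each tuple b of the product B of
   their vertex sets to its q coordinates.  In a K-colouring, each of q given
   colours can be found in a G_i of its own, so some b sees all of them: B never
   uses only q colours, although it can as soon as one edge is deleted.  If
   q + r + 1 = K, two such gadgets, with their sets B completely joined, form a
   triangle-free (K + 1)-critical graph, and for q >= 2 the set B is much larger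
   than the rest of its gadget.  Balancing the two sides gives n^2/16 edges for
   (K, q, r) = (3, 1, 1), 4n^2/31 for (4, 1, 2) and n^2/4 for (K, 2, K - 3), the
   last being optimal by Mantel's theorem. *)
Require Import Defs.
From mathcomp Require Import all_boot all_order all_algebra.
From mathcomp Require Import boolp classical_sets reals.
From mathcomp Require Import zify ring lra.
Import Order.TTheory GRing.Theory Num.Theory.
Set Implicit Arguments.
Unset Strict Implicit.

(** * Colourings and critical graphs *)

Definition proper_col {T : Type} (e : rel T) (f : T -> nat) : Prop :=
  forall x y, e x y -> f x != f y.

Definition kcolorable {T : Type} (e : rel T) (k : nat) : Prop :=
  exists f, (forall x, f x < k) /\ proper_col e f.

Definition del_edge {T : eqType} (e : rel T) (x y : T) : rel T :=
  fun u v => e u v && ~~ (((u == x) && (v == y)) || ((u == y) && (v == x))).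

Definition arcs {T : finType} (e : rel T) : nat := \sum_x \sum_y e x y.

(** No vertex is isolated, so at any vertex there is an edge to delete; [tf_critical_col1] rests on
    this. *)
Record tf_graph {T : finType} (e : rel T) : Prop := TfGraph {
  tf_sym : symmetric e;
  tf_irr : irreflexive e;
  tf_tri : forall x y z, e x y -> e y z -> e z x -> False;
  tf_nbr : forall x, exists y, e x y }.

(* Chromatic number [k.+1], not [k]. *)
Record tf_critical (k : nat) {T : finType} (e : rel T) : Prop := TfCritical {
  tfc_graph : tf_graph e;
  tfc_chi : ~ kcolorable e k;
  tfc_del : forall x y, e x y -> kcolorable (del_edge e x y) k }.

Lemma kcolorable_seq (T : Type) (e : rel T) (f : T -> nat) (s : seq nat) :
  (forall x, f x \in s) -> proper_col e f -> kcolorable e (size s).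
Proof.
move=> fs fP; exists (fun x => index (f x) s); split=> [x|x y exy].
  by rewrite index_mem.
apply: contra (fP _ _ exy) => /eqP h.
by rewrite -(nth_index 0 (fs x)) h nth_index.
Qed.

Lemma kcolorableW (T : Type) (e : rel T) (j k : nat) :
  j <= k -> kcolorable e j -> kcolorable e k.
Proof. by move=> jk [f [fj fP]]; exists f; split=> // x; apply: leq_trans jk. Qed.

Lemma tf_critical_inhab (k : nat) (T : finType) (e : rel T) :
  tf_critical k e -> exists x : T, true.
Proof.
move=> [_ chi _]; case: (pickP (fun _ : T => true)) => [x _|no]; first by exists x.
by case: chi; exists (fun=> 0); split=> x; have := no x.
Qed.

(** Deleting an edge at [v] leaves a graph colourable with [k] colours; shifting these up by one
    frees the colour 0 for [v] alone. *)
Lemma tf_critical_col1 (k : nat) (T : finType) (e : rel T) (v : T) :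
  tf_critical k e ->
  exists f : T -> nat, [/\ forall x, f x < k.+1, proper_col e f
    & forall x, (f x == 0) = (x == v)].
Proof.
move=> [[sym irr _ nbr] _ del]; have [y evy] := nbr v.
have [g [gk gP]] := del _ _ evy.
exists (fun x => if x == v then 0 else (g x).+1); split=> [x|x z exz|x].
- by case: eqP => // _; rewrite ltnS.
- case: (x =P v) => [xv|/eqP xv]; case: (z =P v) => [zv|/eqP zv] //.
    by move: exz; rewrite xv zv irr.
  rewrite eqSS; apply: gP; rewrite /del_edge exz (negPf xv) (negPf zv) /=.
  by rewrite andbF.
- by case: (x =P v).
Qed.

(** * Gadgets *)

(* Every vertex of [B] will be joined to the vertices of [A] in [nb b]; [B]
   then needs more than [q] of the [K] colours, and can do with [q] as soon as
   one edge is deleted. *)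
Record gadget (K q : nat) {A B : finType} (e : rel A) (nb : B -> seq A) : Prop :=
 Gadget {
  g_graph : tf_graph e;
  g_inh : exists b : B, true;
  g_ind : forall b x y, x \in nb b -> y \in nb b -> ~~ e x y;
  g_size : forall b, size (nb b) <= q;
  g_full : forall (f : A -> nat) (s : seq nat), (forall x, f x < K) ->
    proper_col e f -> uniq s -> all (fun c => c < K) s -> size s <= q ->
    exists b, {subset s <= map f (nb b)};
  g_del : forall x y, e x y -> exists (f : A -> nat) (g : B -> nat),
    [/\ forall x, f x < K, proper_col (del_edge e x y) f
      & forall b, g b < q /\ g b \notin map f (nb b)];
  g_one : forall b, exists (f : A -> nat) (g : B -> nat),
    [/\ forall x, f x < K, proper_col e f,
        uniq (map f (nb b)) /\ all (fun c => c < q) (map f (nb b))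
      & forall t, t != b -> g t < q /\ g t \notin map f (nb t)] }.

(** One more factor of Zykov's product: the core grows by a disjoint critical graph, and each tuple
    by a coordinate in it. *)
Definition core_step {A V : finType} (e : rel A) (h : rel V) : rel (A + V) :=
  fun x y => match x, y with
  | inl a, inl a' => e a a' | inr v, inr v' => h v v' | _, _ => false end.

Definition nb_step {A B V : finType} (nb : B -> seq A) (p : B * V) : seq (A + V) :=
  inr p.2 :: map inl (nb p.1).

Lemma map_nb_step (A B V : finType) (nb : B -> seq A) (p : B * V) (f : A + V -> nat) :
  map f (nb_step nb p) = f (inr p.2) :: map (fun a => f (inl a)) (nb p.1).
Proof. by rewrite /= -map_comp. Qed.

Lemma gadget0 (K : nat) : gadget K 0 (fun _ _ : void => false) (fun _ : unit => [::]).
Proof.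
split=> //.
- by move=> f [|c s] // _ _ _ _ _; exists tt.
- by move=> [] ; exists (fun=> 0), (fun=> 0); split=> // -[].
Qed.

Lemma missing_color (s : seq nat) (q : nat) :
  size s <= q -> exists c, c < q.+1 /\ c \notin s.
Proof.
move=> sq; case: (boolP (all (mem s) (iota 0 q.+1))) => [/allP h|].
  have := uniq_leq_size (iota_uniq 0 q.+1) h; rewrite size_iota.
  by move/leq_trans/(_ sq); rewrite ltnn.
by case/allPn=> c; rewrite mem_iota => cq cs; exists c; split; first lia.
Qed.

(** The new factor has chromatic number [j + 1 = K - q]. Hence it cannot avoid [q + 1] given
    colours, and the other [q] are left to the old factors. *)
Lemma gadget_step (K q j : nat) (A B V : finType) (e : rel A) (nb : B -> seq A)
    (h : rel V) :
  K = q + j + 1 -> gadget K q e nb -> tf_critical j h ->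
  gadget K q.+1 (core_step e h) (nb_step (V := V) nb).
Proof.
move=> KE [[sym irr tri nbr] [b0 _] ind sz full del one] hc.
have [[hsym hirr htri hnbr] hchi hdel] := hc.
have [v0 _] := tf_critical_inhab hc.
split.
- split.
  + by case=> [a|v] [a'|v'] /=; rewrite ?(sym a) ?(hsym v).
  + by case=> [a|v] /=.
  + by case=> [a|v] [a'|v'] [a''|v''] //=; [apply: tri|apply: htri].
  + case=> [a|v]; first by have [a' h'] := nbr a; exists (inl a').
    by have [a' h'] := hnbr v; exists (inr a').
- by exists (b0, v0).
- move=> [b v] x y; rewrite /nb_step /= !inE.
  case/predU1P=> [->|/mapP [a ab ->]] /predU1P [->|/mapP [a' ab' ->]] //=.
    by rewrite hirr.
  exact: ind ab ab'.
- by move=> [b v]; rewrite /nb_step /= size_map ltnS.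
- move=> f s fK fP us sK sq.
  pose fa a := f (inl a); pose fv v := f (inr v).
  have faK x : fa x < K by exact: fK.
  have faP : proper_col e fa by move=> x y exy; apply: fP.
  have [le|lt] := leqP (size s) q.
    have [b hb] := full fa s faK faP us sK le.
    by exists (b, v0) => c /hb cb; rewrite map_nb_step inE cb orbT.
  (* Here [s] has [q + 1] colours, so at most [j] colours lie outside it, too few for [h]. *)
  have [v vs] : exists v, fv v \in s.
    case: (pickP (fun v => fv v \in s)) => [v vs|no]; first by exists v.
    case: hchi; pose s' := [seq c <- iota 0 K | c \notin s].
    have : uniq (s' ++ s).
      rewrite cat_uniq us filter_uniq ?iota_uniq // andbT /= -all_predC.
      by apply/allP => c cs; rewrite /= mem_filter cs.
    move/(@uniq_leq_size _ _ (iota 0 K)); rewrite size_cat size_iota => h1.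
    have s'j : size s' <= j.
      suff : size s' + size s <= K by lia.
      apply: h1 => c; rewrite mem_cat mem_filter => /orP [/andP [] //|cs].
      by rewrite mem_iota add0n; move/allP: sK => /(_ c cs).
    apply: kcolorableW s'j _; apply: (@kcolorable_seq _ _ fv).
      by move=> x; rewrite mem_filter no mem_iota add0n; apply: fK.
    by move=> x y hxy; apply: fP.
  have [] := full fa (rem (fv v) s) faK faP; first exact: rem_uniq.
  - by apply/allP => c /mem_rem cs; move/allP: sK => /(_ c cs).
  - by rewrite size_rem // -ltnS prednK //; apply: leq_ltn_trans lt.
  move=> b hb; exists (b, v) => c cs; rewrite map_nb_step inE /=.
  case: eqP => //= /eqP ne; apply: hb.
  by rewrite mem_rem_uniq // inE ne.
- case=> [x|x] [y|y] //= exy.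
  (* The colours from [q] up suffice for the new factor, and they cannot clash with the colours of
     [B], all below [q]. *)
  + have [f [g [fK fP gP]]] := del _ _ exy.
    have [f' [f'K f'P _]] := tf_critical_col1 v0 hc.
    exists (fun z => match z with inl a => f a | inr v => q + f' v end).
    exists (fun p => g p.1); split.
    * by case=> // v; have := f'K v; lia.
    * case=> [a|v] [a'|v'] //=; first exact: fP.
      by case/andP=> /f'P; rewrite eqn_add2l.
    * move=> [b v] /=; have [gq gn] := gP b; split; first by lia.
      rewrite -map_comp inE negb_or [X in _ && X]gn andbT; lia.
  (* The new factor now needs only [j] colours, all taken above [q]. A tuple sees at most [q]
     colours in the old core, so one of the [q + 1] colours up to [q] is free. *)
  + have [g [gj gP]] := hdel _ _ exy.
    have [f0 [f0K f0P]] : exists f0 : A -> nat, (forall x, f0 x < K) /\ proper_col e f0.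
      by have [f [_ [? ? _ _]]] := one b0; exists f.
    have ch (p : B * V) : exists c, c < q.+1 /\ c \notin map f0 (nb p.1).
      by apply: missing_color; rewrite size_map.
    have [g0 g0P] := fin_all_exists ch.
    exists (fun z => match z with inl a => f0 a | inr v => q.+1 + g v end), g0.
    split.
    * by case=> // v; have := gj v; lia.
    * case=> [a|v] [a'|v'] //=; first by case/andP=> /f0P.
      by rewrite eqn_add2l => /gP.
    * move=> [b v]; have [lt nin] := g0P (b, v); split=> //.
      rewrite inE negb_or -map_comp [X in _ && X]nin andbT /=; lia.
(* Only [v] gets the colour [q] in the new factor: it completes the distinct colours seen by
   [(b, v)] and is free for the tuples [(b, w)] with [w] other than [v]. *)
- move=> [b v]; have [f [g [fK fP [fu fq] gP]]] := one b.
  have [f' [f'K f'P f'0]] := tf_critical_col1 v hc.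
  exists (fun z => match z with inl a => f a | inr v => q + f' v end).
  exists (fun p => if p.1 == b then q else g p.1); split.
  + by case=> // w; have := f'K w; lia.
  + case=> [a|w] [a'|w'] //=; first exact: fP.
    by move/f'P; rewrite eqn_add2l.
  + rewrite map_nb_step /=; have -> : f' v = 0 by apply/eqP; rewrite f'0.
    split; last first.
      rewrite addn0 ltnSn /=; apply: sub_all fq => c; lia.
    rewrite [X in _ && X]fu andbT addn0; apply/negP => qin.
    by move/allP: fq => /(_ _ qin); rewrite ltnn.
  + move=> [t w] ne; rewrite map_nb_step inE negb_or /=.
    case: (t =P b) => [tb|/eqP tb].
      have wv : w != v by move: ne; rewrite tb xpair_eqE eqxx.
      split; first exact: ltnSn.
      have -> : q != q + f' w by move: wv; rewrite -f'0; lia.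
      rewrite tb /=; apply/negP => qin.
      by move/allP: fq => /(_ _ qin); rewrite ltnn.
    have [gq gn] := gP _ tb; split; first lia.
    by rewrite [X in _ && X]gn andbT; lia.
Qed.

(** * Gadgets as halves of a critical graph *)

Lemma uniq_map_inj (T1 T2 : eqType) (f : T1 -> T2) (s : seq T1) :
  uniq (map f s) -> {in s &, injective f}.
Proof.
elim: s => //= a s IH /andP [fa us] x y.
rewrite !inE => /predU1P [->|xs] /predU1P [->|ys] E //.
- by move: fa; rewrite E map_f.
- by move: fa; rewrite -E map_f.
- exact: (IH us).
Qed.

(** What the join uses of a gadget, with the edges between core and tuples included; [P] marks the
    tuples. Vertices in [P] get their neighbours from the join, hence the restriction in [h_nbr]. By
    [h_one], a single chosen vertex of [P] can carry the one extra colour [q]. *)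
Record half (K q : nat) {V : finType} (e : rel V) (P : pred V) : Prop := Half {
  h_sym : symmetric e;
  h_irr : irreflexive e;
  h_tri : forall x y z, e x y -> e y z -> e z x -> False;
  h_nbr : forall x, ~~ P x -> exists y, e x y;
  h_inh : exists x, P x;
  h_ind : forall x y, P x -> P y -> e x y = false;
  h_full : forall (f : V -> nat) (s : seq nat), (forall x, f x < K) ->
    proper_col e f -> uniq s -> all (fun c => c < K) s -> size s <= q ->
    exists x, P x /\ f x \notin s;
  h_del : forall x y, e x y -> exists f : V -> nat,
    [/\ forall x, f x < K, proper_col (del_edge e x y) f
      & forall x, P x -> f x < q];
  h_one : forall x, P x -> exists f : V -> nat,
    [/\ forall x, f x < K, proper_col e f, f x = q
      & forall y, P y -> y != x -> f y < q] }.

Definition half_rel {A B : finType} (e : rel A) (nb : B -> seq A) : rel (A + B) :=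
  fun x y => match x, y with
  | inl a, inl a' => e a a'
  | inl a, inr b => a \in nb b
  | inr b, inl a => a \in nb b
  | inr _, inr _ => false end.

Definition is_inr {A B : Type} (x : A + B) : bool := if x is inr _ then true else false.

Definition glue {A B C : Type} (f : A -> C) (g : B -> C) (x : A + B) : C :=
  match x with inl a => f a | inr b => g b end.

(** A tuple that sees all colours of [s] must itself be coloured outside [s], which gives
    [h_full]. *)
Lemma gadget_half (K q : nat) (A B : finType) (e : rel A) (nb : B -> seq A) :
  q < K -> gadget K q e nb -> half K q (half_rel e nb) is_inr.
Proof.
move=> qK [[sym irr tri nbr] [b0 _] ind sz full del one]; split.
- by case=> [a|b] [a'|b'] /=.
- by case=> [a|b] /=.
- case=> [a|b] [a'|b'] [a''|b''] //=; first exact: tri.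
  + by move=> e1 e2 e3; have := ind _ _ _ e2 e3; rewrite sym e1.
  + by move=> e1 e2 e3; have := ind _ _ _ e1 e2; rewrite sym e3.
  + by move=> e1 e2 e3; have := ind _ _ _ e1 e3; rewrite e2.
- by case=> [a|b] // _; have [a' h'] := nbr a; exists (inl a').
- by exists (inr b0).
- by case=> [a|b] [a'|b'].
- move=> f s fK fP us sK sq.
  have [//||b hb] := full (fun a => f (inl a)) s _ _ us sK sq.
    by move=> x y exy; apply: fP.
  exists (inr b); split=> //; apply/negP => /hb /mapP [a ab E].
  by have := fP (inr b) (inl a) ab; rewrite E eqxx.
(* The colouring of [g_one] gives the neighbours of [b] distinct colours below [q]. Once the edge
   from [a] to [b] is deleted, [b] can therefore take the colour of [a]. *)
- have del_b (a : A) (b : B) : a \in nb b -> exists f : A + B -> nat,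
    [/\ forall x, f x < K,
        forall x y, half_rel e nb x y ->
          ~~ ((x == inl a) && (y == inr b) || (x == inr b) && (y == inl a)) ->
          f x != f y
      & forall x, is_inr x -> f x < q].
    move=> ab; have [f [g [fK fP [fu fq] gP]]] := one b.
    have fbq : f a < q by move/allP: fq; apply; apply: map_f.
    exists (glue f (fun t => if t == b then f a else g t)); split.
    + case=> //= t; case: eqP => // /eqP tb.
      by have [gq _] := gP _ tb; apply: ltn_trans qK.
    + have cross a' t : a' \in nb t -> ~~ ((a' == a) && (t == b)) ->
          f a' != (if t == b then f a else g t).
        move=> at_; case: (t =P b) => [tb|/eqP tb].
          rewrite andbT => /negP ne; apply/negP => /eqP E; apply: ne; apply/eqP.
          by apply: (uniq_map_inj fu) => //; rewrite -tb.
        move=> _; have [_ gn] := gP _ tb; apply: contra gn => /eqP <-.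
        exact: map_f.
      case=> [x|x] [y|y] //=; first by move=> exy _; apply: fP.
        by rewrite orbF => h1 h2; apply: cross.
      by move=> h1 h2; rewrite eq_sym; apply: cross => //; rewrite andbC.
    + case=> //= t _; case: eqP => // /eqP tb.
      by have [] := gP _ tb.
  case=> [a|b] [a'|b'] //= exy.
  + have [f [g [fK fP gP]]] := del _ _ exy; exists (glue f g); split.
    * by case=> //= b; have [] := gP b; lia.
    * have cross a1 b1 : a1 \in nb b1 -> f a1 != g b1.
        by move=> ab; have [_] := gP b1; apply: contra => /eqP <-; apply: map_f.
      case=> [x|x] [y|y] /andP [h1 h2] //=; first by apply: fP; apply/andP.
        exact: cross.
      by rewrite eq_sym; apply: cross.
    * by case=> //= b _; have [] := gP b.
  + have [f [fK fP fq]] := del_b _ _ exy; exists f; split=> // x y /andP [h1 h2].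
    exact: fP.
  + have [f [fK fP fq]] := del_b _ _ exy; exists f; split=> // x y /andP [h1 h2].
    by apply: fP => //; rewrite orbC.
(* Since [b] sees only colours below [q], it can take [q] itself. *)
- case=> // b _; have [f [g [fK fP [fu fq] gP]]] := one b.
  exists (glue f (fun t => if t == b then q else g t)); split.
  + case=> //= t; case: eqP => // /eqP tb.
    by have [gq _] := gP _ tb; apply: ltn_trans qK.
  + have cross a' t : a' \in nb t -> f a' != (if t == b then q else g t).
      move=> at_; case: (t =P b) => [tb|/eqP tb].
        rewrite neq_ltn; apply/orP; left; move/allP: fq; apply.
        by apply: map_f; rewrite -tb.
      have [_ gn] := gP _ tb; apply: contra gn => /eqP <-; exact: map_f.
    case=> [x|x] [y|y] //=; first exact: fP.
      exact: cross.
    by rewrite eq_sym; apply: cross.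
  + by rewrite /= eqxx.
  + by case=> //= t _ tb; case: eqP => [E|/eqP ne]; [rewrite E eqxx in tb|have [] := gP _ ne].
Qed.

(** * Joining two halves *)

Definition join_rel {V W : finType} (e : rel V) (P : pred V) (h : rel W) (Q : pred W)
    : rel (V + W) :=
  fun x y => match x, y with
  | inl v, inl v' => e v v'
  | inr w, inr w' => h w w'
  | inl v, inr w => P v && Q w
  | inr w, inl v => P v && Q w end.

(** The colours on [P] and on [Q] are disjoint. With only [q + r + 1] colours, [P] has at most [q]
    or [Q] at most [r], contradicting [h_full] of one half. *)
Lemma join_critical (K q r : nat) (V W : finType) (e : rel V) (P : pred V)
    (h : rel W) (Q : pred W) :
  K = q + r + 1 -> half K q e P -> half K r h Q ->
  tf_critical K (join_rel e P h Q).
Proof.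
move=> KE [sym irr tri nbr [v0 Pv0] ind full del one].
move=> [hsym hirr htri hnbr [w0 Qw0] hind hfull hdel hone].
split.
- split.
  + by case=> [v|w] [v'|w'] //=; rewrite ?(sym v) ?(hsym w).
  + by case=> [v|w] /=.
  + case=> [v|w] [v'|w'] [v''|w''] //=; try by [apply: tri|apply: htri].
    * by move=> e1 /andP [p1 q1] /andP [p2 q2]; rewrite ind in e1.
    * by move=> /andP [p1 q1] /andP [p2 q2] e1; rewrite ind in e1.
    * by move=> /andP [p1 q1] e1 /andP [p2 q2]; rewrite hind in e1.
    * by move=> /andP [p1 q1] e1 /andP [p2 q2]; rewrite ind in e1.
    * by move=> /andP [p1 q1] /andP [p2 q2] e1; rewrite hind in e1.
    * by move=> e1 /andP [p1 q1] /andP [p2 q2]; rewrite hind in e1.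
  + case=> [v|w].
      case: (boolP (P v)) => [Pv|/nbr [y vy]]; last by exists (inl y).
      by exists (inr w0); rewrite /= Pv Qw0.
    case: (boolP (Q w)) => [Qw|/hnbr [y wy]]; last by exists (inr y).
    by exists (inl v0); rewrite /= Pv0 Qw.
- move=> [f [fK fP]].
  pose s := undup [seq f (inl v) | v <- enum P].
  pose t := undup [seq f (inr w) | w <- enum Q].
  have inK (s' : seq nat) : {subset s' <= codom f} -> all (fun c => c < K) s'.
    by move=> sub; apply/allP => c /sub /codomP [x ->].
  have ss : {subset s <= codom f}.
    by move=> c; rewrite mem_undup => /mapP [v _ ->]; apply: codom_f.
  have ts : {subset t <= codom f}.
    by move=> c; rewrite mem_undup => /mapP [v _ ->]; apply: codom_f.
  have us : size (s ++ t) <= K.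
    rewrite -(size_iota 0 K); apply: uniq_leq_size.
      rewrite cat_uniq !undup_uniq andbT /=; apply/hasPn => c.
      rewrite !mem_undup => /mapP [w wQ ->]; apply/negP => /mapP [v vP E].
      move: vP wQ; rewrite !mem_enum => vP wQ.
      have PQ : join_rel e P h Q (inl v) (inr w) by apply/andP.
      by have := fP _ _ PQ; rewrite E eqxx.
    move=> c; rewrite mem_iota mem_cat => /orP [/ss|/ts] /codomP [x ->]; exact: fK.
  rewrite size_cat KE in us.
  have [sq|sq] := leqP (size s) q.
    have [] := full (fun v => f (inl v)) s _ _ (undup_uniq _) (inK _ ss) sq => //.
      by move=> x y exy; apply: fP.
    move=> x [Px]; rewrite mem_undup => /negP; apply.
    by apply: map_f; rewrite mem_enum.
  have tr : size t <= r by lia.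
  have [] := hfull (fun v => f (inr v)) t _ _ (undup_uniq _) (inK _ ts) tr => //.
    by move=> x y exy; apply: fP.
  move=> x [Qx]; rewrite mem_undup => /negP; apply.
  by apply: map_f; rewrite mem_enum.
- pose flip (f : W -> nat) w := q + r - f w.
  (* The two sides use disjoint palettes, [0, q) and (q, K), up to the colour [q]. *)
  have flipP (h' : rel W) f : (forall w, f w < K) -> proper_col h' f ->
      proper_col h' (flip f).
    move=> fK fP x y /fP; rewrite /flip.
    by have := fK x; have := fK y; lia.
  have flipK f w : flip f w < K by rewrite /flip; lia.
  (* When a joining edge is deleted, its two ends share the colour [q]; the rest of [P] lies below
     [q] and the rest of [Q], after the flip, above. *)
  have del_x (v : V) (w : W) : P v -> Q w -> exists f : V + W -> nat,
    (forall x, f x < K) /\ forall x y, join_rel e P h Q x y ->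
      ~~ ((x == inl v) && (y == inr w) || (x == inr w) && (y == inl v)) ->
      f x != f y.
    move=> Pv Qw; have [f [fK fP fv fq]] := one _ Pv.
    have [g [gK gP gw gr]] := hone _ Qw.
    exists (glue f (flip g)); split; first by case=> //= w'.
    have cross x y : P x && Q y -> ~~ ((x == v) && (y == w)) -> f x != flip g y.
      move=> /andP [Px Qy]; rewrite /flip.
      case: (x =P v) => [->|/eqP xv]; case: (y =P w) => [->|/eqP yw] // _.
      - by rewrite fv; have := gr _ Qy yw; lia.
      - by rewrite gw; have := fq _ Px xv; lia.
      - by have := gr _ Qy yw; have := fq _ Px xv; lia.
    case=> [x|x] [y|y] /= h1 h2; first exact: fP.
    + by apply: cross => //; move: h2; rewrite /= orbF.
    + by rewrite eq_sym; apply: cross => //; rewrite andbC.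
    + exact: flipP h1.
  case=> [x|x] [y|y] /= exy.
  (* An edge deleted inside one half lets that half do without [q] on its marked set, so one marked
     vertex of the other half may use [q]. *)
  + have [f [fK fP fq]] := del _ _ exy.
    have [g [gK gP gw gr]] := hone _ Qw0.
    have cross v w : P v && Q w -> f v != flip g w.
      move=> /andP [Pv Qw]; have := fq _ Pv; rewrite /flip.
      by case: (w =P w0) => [->|/eqP ne]; [rewrite gw|have := gr _ Qw ne]; lia.
    exists (glue f (flip g)); split; first by case=> //= w'.
    case=> [u|u] [u'|u'] /andP [/= h1 h2].
    * by apply: fP; apply/andP.
    * exact: cross.
    * by rewrite eq_sym; apply: cross.
    * exact: flipP h1.
  + have /andP [Px Qy] := exy; have [f [fK fP]] := del_x _ _ Px Qy.
    by exists f; split=> // u u' /andP [h1 h2]; apply: fP.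
  + have /andP [Px Qy] := exy; have [f [fK fP]] := del_x _ _ Px Qy.
    by exists f; split=> // u u' /andP [h1 h2]; apply: fP => //; rewrite orbC.
  + have [g [gK gP gr]] := hdel _ _ exy.
    have [f [fK fP fv fq]] := one _ Pv0.
    have cross v w : P v && Q w -> f v != flip g w.
      move=> /andP [Pv Qw]; have := gr _ Qw; rewrite /flip.
      by case: (v =P v0) => [->|/eqP ne]; [rewrite fv|have := fq _ Pv ne]; lia.
    exists (glue f (flip g)); split; first by case=> //= w'.
    case=> [u|u] [u'|u'] /andP [/= h1 h2].
    * exact: fP.
    * exact: cross.
    * by rewrite eq_sym; apply: cross.
    * by apply: (flipP _ _ gK gP); apply/andP.
Qed.

(** * Counting arcs *)

Lemma arcs_core_step (A V : finType) (e : rel A) (h : rel V) :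
  arcs e + arcs h <= arcs (core_step e h).
Proof.
rewrite /arcs big_sumType /=; apply: leq_add; apply: leq_sum => x _.
  by rewrite big_sumType /= leq_addr.
by rewrite big_sumType /= leq_addl.
Qed.

Lemma arcs_half (A B : finType) (e : rel A) (nb : B -> seq A) :
  arcs e <= arcs (half_rel e nb).
Proof.
rewrite /arcs big_sumType /=; apply: leq_trans (leq_addr _ _); apply: leq_sum => x _.
by rewrite big_sumType /= leq_addr.
Qed.

Lemma arcs_join (V W : finType) (e : rel V) (P : pred V) (h : rel W) (Q : pred W) :
  arcs (join_rel e P h Q) = arcs e + arcs h + 2 * (#|P| * #|Q|).
Proof.
have PQ : \sum_v \sum_w (P v && Q w : nat) = #|P| * #|Q|.
  rewrite -!sum1_card big_distrl /= [RHS]big_mkcond; apply: eq_bigr => v _.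
  rewrite big_distrr /= [in RHS]big_mkcond /= unfold_in; case: (P v).
    by apply: eq_bigr => w _; rewrite unfold_in; case: (Q w).
  by rewrite big1.
rewrite /arcs big_sumType /= (eq_bigr (fun v => \sum_v' e v v' + \sum_w (P v && Q w : nat)));
  last by move=> v _; rewrite big_sumType.
rewrite [X in _ + X](eq_bigr (fun w => \sum_v (P v && Q w : nat) + \sum_w' h w w'));
  last by move=> v _; rewrite big_sumType.
rewrite !big_split /= [X in _ + (X + _)]exchange_big /= PQ; lia.
Qed.

(** * Odd cycles *)

Definition cyc_succ {n : nat} (x y : 'I_n) : bool :=
  (y == x.+1 :> nat) || (x == n.-1 :> nat) && (y == 0 :> nat).

Definition cycle_rel (n : nat) : rel 'I_n := fun x y => cyc_succ x y || cyc_succ y x.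

Lemma cycle_critical (m : nat) : 2 <= m -> tf_critical 2 (@cycle_rel m.*2.+1).
Proof.
move=> m2; split.
- split.
  + by move=> x y; rewrite /cycle_rel orbC.
  + by move=> x; rewrite /cycle_rel /cyc_succ; lia.
  + by move=> x y z; rewrite /cycle_rel /cyc_succ; lia.
  + move=> x; have [lt|ge] := ltnP x m.*2.
      have h : x.+1 < m.*2.+1 by [].
      by exists (Ordinal h); rewrite /cycle_rel /cyc_succ /= eqxx.
    by exists ord0; rewrite /cycle_rel /cyc_succ /=; have := ltn_ord x; lia.
- move=> [f [f2 fP]].
  (* Colours alternate from vertex 0, so the last vertex, of even index, repeats the colour of its
     neighbour 0. *)
  have fS j (h : j < m.*2.+1) : f (Ordinal h) = (f ord0 + odd j) %% 2.
    elim: j h => [|j IH] h.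
      rewrite addn0 modn_small //; congr f; exact: val_inj.
    have h' : j < m.*2.+1 by lia.
    have := fP (Ordinal h') (Ordinal h); rewrite /cycle_rel /cyc_succ /= eqxx.
    move/(_ isT); rewrite (IH h'); have := f2 (Ordinal h); have := f2 ord0.
    by move: (f ord0) (f (Ordinal h)) => [|[|?]] // [|[|?]] //=; case: (odd j).
  have last_adj : @cycle_rel m.*2.+1 ord_max ord0 by rewrite /cycle_rel /cyc_succ /= eqxx.
  have := fP _ _ last_adj.
  have -> : ord_max = Ordinal (ltnSn m.*2) by exact: val_inj.
  by rewrite fS odd_double addn0 modn_small // eqxx.
(* Parity, flipped beyond [i]: since the length is odd, the flip repairs the closing edge and spoils
   only the edge from [i] to its successor. *)
- pose col (i j : 'I_m.*2.+1) : nat := odd j (+) (i < j).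
  have colP i u v : cyc_succ u v -> u != i -> col i u != col i v.
    rewrite /col /cyc_succ => uv; rewrite -val_eqE /= => ui.
    have -> : odd v (+) (i < v) = ~~ (odd u (+) (i < u)).
      case/orP: uv => [/eqP ->|/andP [/eqP um /eqP ->]].
        by rewrite oddS addNb; congr (~~ (_ (+) _)); lia.
      by rewrite um odd_double ltn0 /=; have := ltn_ord i; lia.
    by case: (_ (+) _).
  have succ_fun (u v w : 'I_m.*2.+1) : cyc_succ u v -> cyc_succ u w -> v = w.
    move=> uv uw; apply: val_inj; move: uv uw; rewrite /cyc_succ /=.
    by have := ltn_ord v; have := ltn_ord w; lia.
  have main x y : cyc_succ x y -> kcolorable (del_edge (@cycle_rel m.*2.+1) x y) 2.
    move=> xy; exists (col x); split=> [j|u v]; first by rewrite /col; case: (_ (+) _).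
    case/andP=> /orP [uv|vu] ne.
      apply: colP => //; apply: contra ne => /eqP ux; rewrite ux eqxx.
      by rewrite ux in uv; rewrite (succ_fun _ _ _ uv xy) eqxx.
    rewrite eq_sym; apply: colP => //; apply: contra ne => /eqP vx; rewrite vx eqxx.
    by rewrite vx in vu; rewrite (succ_fun _ _ _ vu xy) eqxx /= orbT.
  move=> x y /orP [xy|yx]; first exact: main.
  have [f [f2 fP]] := main _ _ yx; exists f; split=> // u v /andP [h1 h2].
  by apply: fP; rewrite /del_edge h1 orbC.
Qed.

(** * Orders and sizes *)

(* Orders are exact, whereas the number of arcs (twice the number of edges) is
   only bounded from below. *)
Definition critG (k n E : nat) : Prop := exists (T : finType) (e : rel T),
  [/\ tf_critical k e, #|T| = n & E <= arcs e].

Definition gadG (K q a b E : nat) : Prop :=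
  exists (A B : finType) (e : rel A) (nb : B -> seq A),
  [/\ gadget K q e nb, #|A| = a, #|B| = b & E <= arcs e].

Lemma gadG0 (K : nat) : gadG K 0 0 1 0.
Proof. by do 4!eexists; split; [exact: gadget0|rewrite card_void|rewrite card_unit|]. Qed.

Lemma gadG_step (K q j a b n E E' : nat) : K = q + j + 1 ->
  gadG K q a b E -> critG j n E' -> gadG K q.+1 (a + n) (b * n) (E + E').
Proof.
move=> KE [A [B [e [nb [gad <- <- eE]]]]] [T [h [crit <- hE]]].
do 4!eexists; split; [exact: gadget_step KE gad crit|by rewrite card_sum|by rewrite card_prod|].
by apply: leq_trans (arcs_core_step _ _); apply: leq_add.
Qed.

(** Only the edges inside the cores and between the two sets of tuples are counted; those from
    tuples to cores are of lower order. *)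
Lemma critG_join (K q r a b a' b' E E' : nat) : K = q + r + 1 ->
  gadG K q a b E -> gadG K r a' b' E' ->
  critG K (a + b + (a' + b')) (E + E' + 2 * (b * b')).
Proof.
move=> KE [A [B [e [nb [gad <- <- eE]]]]] [A' [B' [h [nb' [gad' <- <- hE]]]]].
have qK : q < K by lia.
have rK : r < K by lia.
do 2!eexists; split; [exact: join_critical KE (gadget_half qK gad) (gadget_half rK gad')| |].
  by rewrite !card_sum.
have inrE (C D : finType) : #|@is_inr C D| = #|D|.
  rewrite -(card_imset predT (@inr_inj C D)); apply: eq_card => x.
  rewrite unfold_in; apply/idP/imsetP => [|[y _ ->] //].
  by case: x => // d _; exists d.
rewrite arcs_join !inrE; have := arcs_half e nb; have := arcs_half h nb'; lia.
Qed.

Lemma critGW (k n E E' : nat) : E' <= E -> critG k n E -> critG k n E'.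
Proof. by move=> le [T [e [? ? ?]]]; exists T, e; split=> //; apply: leq_trans le _. Qed.

(** * Critical graphs and gadgets of unbounded order *)

Lemma critG_cycle (m : nat) : 2 <= m -> critG 2 m.*2.+1 0.
Proof. by move=> m2; exists _, (@cycle_rel m.*2.+1); split=> //; [apply: cycle_critical|rewrite card_ord]. Qed.

(** With a single factor, the tuples form an independent copy of its vertex set, joined to it by
    Toft's matching. *)
Lemma gadG1 (K n E : nat) : critG K n E -> gadG K.+1 1 n n E.
Proof.
by move=> c; have := gadG_step (esym (addn1 (0 + K))) (gadG0 _) c; rewrite !add0n mul1n.
Qed.

(** Toft's graph: two cycles of length [L = 2m + 1], each matched to an independent set, with the
    two sets completely joined. The [L^2] joining edges are [n^2/16]. *)
Lemma critG_toft (m : nat) : 2 <= m ->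
  critG 3 (4 * m.*2.+1) (2 * (m.*2.+1 * m.*2.+1)).
Proof.
move=> m2; have g := gadG1 (critG_cycle m2).
have -> : 4 * m.*2.+1 = m.*2.+1 + m.*2.+1 + (m.*2.+1 + m.*2.+1) by lia.
exact: (critG_join (q := 1) (r := 1) (erefl _) g g).
Qed.

Definition unbounded (k : nat) : Prop := forall N, exists n, N <= n /\ critG k n 0.

(** The factors have parameters [q + j] down to [j], the largest first, so the induction on [q]
    raises [j] and keeps [K] fixed. *)
Lemma gadG_exists (q j N : nat) :
  (forall i, j <= i < q.+1 + j -> unbounded i) ->
  exists a b, N <= b /\ gadG (q.+1 + j) q.+1 a b 0.
Proof.
elim: q j N => [|q IH] j N large.
  have [|n [Nn c]] := large j _ N; first by lia.
  by exists n, n; split=> //; rewrite add1n; apply: gadG1.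
have [|a [b [Nb g]]] := IH j.+1 N.+1; first by move=> i ji; apply: large; lia.
have [|n [Nn c]] := large j _ 1; first by lia.
exists (a + n), (b * n); split; first by nia.
have KE : q.+2 + j = q.+1 + j + 1 by lia.
rewrite -[0]/(0 + 0); apply: (gadG_step KE) c.
by have -> : q.+2 + j = q.+1 + j.+1 by lia.
Qed.

(** Odd cycles serve for [k = 2]. For larger [k], a gadget with factors of parameters 2 to [k - 1]
    is joined to one with a single factor of parameter [k - 1]. *)
Lemma unbounded_all (k : nat) : 2 <= k -> unbounded k.
Proof.
elim/ltn_ind: k => k IH k2 N.
have [->|k3] := eqVneq k 2.
  exists N.+2.*2.+1; split; first by lia.
  exact: critG_cycle.
have [q kE] : exists q, k = q.+1 + 2 by exists (k - 3); lia.
have [|a [b [Nb g]]] := @gadG_exists q 2 N.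
  by move=> i ik; apply: IH; lia.
have [||n [_ c]] := IH k.-1 _ _ 0; [lia|lia|].
have g' := gadG1 c; rewrite prednK in g'; last by lia.
exists (n + n + (a + b)); split; first by lia.
apply: critGW (leq0n _) (critG_join _ g' _); last by rewrite kE; exact: g.
lia.
Qed.

(** * Dense critical graphs *)

(** One gadget has a single factor, a Toft graph on [x] vertices with [x^2/16] edges; the other has
    [y] tuples and a small core. The order is about [2x + y = n], and [xy + x^2/16] is largest,
    [4n^2/31], when [x : y = 8 : 15]. Here [x = 32u^2 + 4], since the cycles in the Toft graph need
    odd length [8u^2 + 1], and [y = 4u * 15u = 60u^2]. *)
Lemma critG_dense5 (m : nat) : 2 <= m ->
  let u := m.*2.+1 in
  critG 4 (124 * (u * u) + 19 * u + 8) (3968 * (u * u * (u * u))).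
Proof.
move=> m2 u.
have u5 : 4 <= u * u by rewrite /u; nia.
have toft1 := @critG_toft (4 * (u * u)) ltac:(lia).
have cyc := @critG_cycle (15 * m + 7) ltac:(lia).
have g2 := gadG_step (erefl : 4 = 1 + 2 + 1) (gadG1 (critG_toft m2)) cyc.
have := critG_join (erefl : 4 = 1 + 2 + 1) (gadG1 toft1) g2.
have -> : (15 * m + 7).*2.+1 = 15 * u by rewrite /u; lia.
rewrite -/u; have -> : (4 * (u * u)).*2.+1 = 8 * (u * u) + 1 by lia.
set n := (X in critG _ X _); have -> : n = 124 * (u * u) + 19 * u + 8.
  by rewrite /n; nia.
by apply: critGW; nia.
Qed.

(** Orders of factors add up in the core but multiply in the tuples, so with at least two large
    factors the core is negligible. *)
Lemma gadG_small_core (q j N : nat) : 2 <= j -> exists a b,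
  [/\ N <= b, N * a <= b & gadG (q.+2 + j) q.+2 a b 0].
Proof.
move=> j2.
have [|a [b [Nb g]]] := @gadG_exists q j.+1 (2 * N).+1.
  by move=> i ij; apply: unbounded_all; lia.
have [n [Nn c]] := unbounded_all j2 (N * a).+1.
exists (a + n), (b * n); split; [by nia|by nia|].
have KE : q.+2 + j = q.+1 + j + 1 by lia.
rewrite -[0]/(0 + 0); apply: (gadG_step KE) c.
by have -> : q.+2 + j = q.+1 + j.+1 by lia.
Qed.

(** Both sides have about [p] tuples and all the rest is of order [p/N], so the density tends to 1/4
    as [N] grows. *)
Lemma critG_dense6 (K N : nat) : 5 <= K -> 1 <= N -> exists n p E,
  [/\ critG K n E, N <= p <= n, N * n <= (2 * N + 3) * p
    & 2 * (N - 1) * (p * p) <= N * E].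
Proof.
move=> K5 N1; have [q KE] : exists q, K = q.+1 + 4 by exists (K - 5); lia.
have [|a0 [s [Ns g0]]] := @gadG_exists q 4 N.
  by move=> i ij; apply: unbounded_all; lia.
have j2 : 2 <= q + 3 by lia.
(* The size asked of [p] makes [a0] and [8 * s] at most [p/N], and the summand [20 * s] makes [t]
   below at least 5. *)
have [a1 [p [Mp Ma g1]]] := gadG_small_core 0 (N * (a0 + 8 * s + 1) + 20 * s) j2.
(* The last factor is a Toft graph, of order [4 * r], chosen so that the two
   sides have almost the same size [p]. *)
have s0 : 0 < 4 * s by lia.
pose t := p %/ (4 * s); pose m := t.-1./2.
have tp : 4 * s * t <= p by rewrite mulnC; apply: leq_trunc_div.
have pt : p < 4 * s * t.+1 by rewrite mulnC; apply: ltn_ceil.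
have t5 : 5 <= t by rewrite /t leq_divRL //; lia.
have m2 : 2 <= m by rewrite /m; lia.
have mt : m.*2.+1 <= t <= m.*2.+2 by rewrite /m; lia.
have g2 := gadG_step (_ : q.+1 + 4 = q.+1 + 3 + 1) g0 (critG_toft m2).
set r := m.*2.+1 in g2 mt.
have KE1 : q.+1 + 4 = 2 + q.+2 + 1 by lia.
have g1' : gadG (q.+1 + 4) 2 a1 p 0.
  by have -> : q.+1 + 4 = 2 + (q + 3) by lia.
have := critG_join KE1 g1' (g2 ltac:(lia)); rewrite -KE.
set n := (X in critG _ X _); set E := (X in critG _ _ X) => c.
have rs : s * (4 * r) <= p by nia.
have rs' : p <= s * (4 * r) + 8 * s.
  have : 4 * s * t.+1 <= 4 * s * (r + 2) by rewrite leq_mul2l; lia.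
  lia.
have Na1 : N * a1 <= p.
  apply: leq_trans Ma; rewrite leq_mul2r; apply/orP; right.
  by apply: leq_trans (leq_addr _ _); rewrite leq_pmulr //; lia.
have Na0 : N * a0 <= p by lia.
have Ns8 : N * (8 * s) <= p by lia.
have Nr : N * (4 * r) <= s * (4 * r) by rewrite leq_mul2r Ns orbT.
exists n, p, E; split=> //.
- have N_le : N <= N * (a0 + 8 * s + 1) by rewrite leq_pmulr //; lia.
  by rewrite /n; lia.
(* The 3 accounts for the core parts [a1], [a0] and [4 * r], each at most [p/N]. *)
- have Nrs : N * (s * (4 * r)) <= N * p by rewrite leq_mul2l rs orbT.
  by rewrite /n; lia.
- have -> : E = 2 * (r * r) + 2 * (p * (s * (4 * r))) by rewrite /E.
  have h : (N - 1) * p <= N * (s * (4 * r)).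
    have : N * p <= N * (s * (4 * r) + 8 * s) by rewrite leq_mul2l rs' orbT.
    by rewrite mulnBl; lia.
  by have := leq_mul h (leqnn (2 * p)); lia.
Qed.

(** * Passage to [graph] *)

Lemma nedges_arcs (G : graph) : (nedges G).*2 = arcs (gadj G).
Proof.
case: G => n e sym irr; rewrite /nedges /arcs /= pair_big /= -sum1_card.
rewrite [RHS](bigID (fun p : 'I_n * 'I_n => p.1 < p.2)) /=.
have lt_part : \sum_(p : 'I_n * 'I_n | p.1 < p.2) (e p.1 p.2 : nat) =
    \sum_(p in [set p : 'I_n * 'I_n | (p.1 < p.2) && e p.1 p.2]) 1.
  rewrite big_mkcond [RHS]big_mkcond; apply: eq_bigr => p _.
  by rewrite inE; case: ltnP => //=; case: (e _ _).
have ge_part : \sum_(p : 'I_n * 'I_n | ~~ (p.1 < p.2)) (e p.1 p.2 : nat) =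
    \sum_(p : 'I_n * 'I_n | p.1 < p.2) (e p.1 p.2 : nat).
  have swapK : cancel (fun p : 'I_n * 'I_n => (p.2, p.1)) (fun p => (p.2, p.1)) by case.
  rewrite (reindex_inj (can_inj swapK)) /= big_mkcond [RHS]big_mkcond.
  apply: eq_bigr => -[x y] _ /=; rewrite sym; case: (ltngtP x y) => //= xy.
  by have -> : x = y by [exact: val_inj]; rewrite irr.
by rewrite ge_part lt_part addnn.
Qed.

Lemma critG_graph (k n E : nat) : critG k n E -> exists G : graph,
  [/\ gn G = n, k_critical k.+1 G, odd_girth_gt 3 G & E <= (nedges G).*2].
Proof.
move=> [T [e [[[sym irr tri nbr] chi del] cT eE]]].
pose adj : rel 'I_#|T| := fun i j => e (enum_val i) (enum_val j).
have adjs : symmetric adj by move=> i j; apply: sym.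
have adji : irreflexive adj by move=> i; apply: irr.
have inv : forall x : T, enum_val (enum_rank x) = x by exact: enum_rankK.
have crit : tf_critical k e by split.
have [v0 _] := tf_critical_inhab crit.
exists (Graph _ _ adjs adji); split=> //.
- split.
  + split.
      have [f [fk fP _]] := tf_critical_col1 v0 crit.
      exists (fun i => Ordinal (fk (enum_val i))) => i j /=; exact: fP.
    move=> j jk [f fP]; apply: chi; apply: (@kcolorableW _ _ j) => //.
    exists (fun x => f (enum_rank x)); split=> // x y exy.
    by apply: fP; rewrite /= /adj !inv.
  + move=> i j /= ij; have [f [fk fP]] := del _ _ ij.
    exists (fun i => Ordinal (fk (enum_val i))) => u v /andP [/= h1 h2].
    by apply: fP; apply/andP; split; rewrite // !(inj_eq enum_val_inj).
- move=> m om m3 [m3' [f [_ fP]]].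
  have E3 : m = 3 by lia.
  subst m; apply: (tri (enum_val (f (inord 0))) (enum_val (f (inord 1))) (enum_val (f (inord 2)))).
  + by have := fP (inord 0); congr (gadj _ _ (f _)); apply: val_inj; rewrite /= !inordK.
  + by have := fP (inord 1); congr (gadj _ _ (f _)); apply: val_inj; rewrite /= !inordK.
  + by have := fP (inord 2); congr (gadj _ _ (f _)); apply: val_inj; rewrite /= !inordK.
- rewrite nedges_arcs /=; apply: leq_trans eE _; rewrite /arcs.
  rewrite (big_enum_val (A := T)) /=; apply: leq_sum => i _.
  by rewrite (big_enum_val (A := T)).
Qed.

(** * Mantel's theorem *)

(** Let [v] have maximum degree. Its neighbours are pairwise nonadjacent, so their arcs all end in
    [out], and the degrees over [out] sum to at least half of all arcs. That sum is at most
    [#|out| * d v], a product of two numbers with sum [#|T|]. *)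
Lemma mantel (T : finType) (e : rel T) : symmetric e ->
  (forall x y z, e x y -> e y z -> e z x -> False) ->
  2 * arcs e <= #|T| ^ 2.
Proof.
move=> sym tri; pose d x := \sum_y e x y.
have dE x : d x = #|[pred y | e x y]|.
  by rewrite -sum1_card [RHS]big_mkcond; apply: eq_bigr => y _; rewrite inE; case: (e x y).
case: (pickP (fun _ : T => true)) => [v0 _|no]; last first.
  by rewrite /arcs big_pred0.
have [v _ vmax] := @arg_maxnP T v0 predT d isT.
pose out := [pred y | ~~ e v y].
have inner : \sum_(x | e v x) d x <= \sum_(x | ~~ e v x) d x.
  rewrite {1}/d exchange_big /= [X in X <= _](bigID (fun y => e v y)) /=.
  rewrite big1 ?add0n; last first.
    move=> y vy; apply: big1 => x vx; case: (boolP (e x y)) => // xy.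
    by case: (tri v x y vx xy); rewrite sym.
  apply: leq_sum => y _; rewrite /d [X in X <= _]big_mkcond; apply: leq_sum => x _.
  by rewrite (sym x); case: (e v x).
have outer : \sum_(x | ~~ e v x) d x <= #|out| * d v.
  by rewrite -sum_nat_const; apply: leq_sum => x _; apply: vmax.
have cards : #|out| + d v = #|T|.
  by rewrite dE addnC -(cardC [pred y | e v y]).
have : arcs e <= 2 * (#|out| * d v).
  rewrite /arcs (bigID (fun x => e v x)) /= -/d; move: inner outer; rewrite /d; lia.
move=> le; rewrite -cards; apply: leq_trans (nat_AGM2 _ _).
by rewrite -[4]/(2 * 2) -mulnA leq_mul2l.
Qed.

Lemma triangle_free_adj (G : graph) : odd_girth_gt 3 G ->
  forall x y z, gadj G x y -> gadj G y z -> gadj G z x -> False.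
Proof.
move=> girth x y z xy yz zx; apply: (girth 3) => //; split=> //.
exists (tnth [tuple x; y; z]); split.
  apply/tuple_uniqP; rewrite /= !inE negb_or andbT.
  have ne u v : gadj G u v -> u != v.
    by move=> uv; apply/eqP => E; move: uv; rewrite E gadj_irr.
  by rewrite ne // (eq_sym x) ne //= ne.
by case=> [] [|[|[|]]] // i; rewrite !(tnth_nth x).
Qed.

Lemma mantel_graph (G : graph) : odd_girth_gt 3 G -> 4 * nedges G <= gn G ^ 2.
Proof.
move=> girth.
have := mantel (gadj_sym G) (triangle_free_adj girth).
rewrite -nedges_arcs card_ord; lia.
Qed.

(** * Density constants *)

Local Open Scope ring_scope.

Lemma density_set_ub (R : realType) (k : nat) : ubound (density_set R 3 k) (1 / 4).
Proof.
move=> c /(_ 1%N) [G [n1 [_ [girth ce]]]].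
have := mantel_graph girth; rewrite -(ler_nat R) natrM natrX.
have : 1 <= (gn G)%:R :> R by rewrite (ler_nat _ 1).
move: ce; set n : R := (gn G)%:R; set E : R := (nedges G)%:R => ce n1' En.
rewrite leNgt; apply/negP => cg.
have : 0 < (c - 1 / 4) * n ^+ 2 by rewrite mulr_gt0 ?subr_gt0 ?exprn_gt0 //; lra.
nra.
Qed.

Lemma density_set_crit (R : realType) (k : nat) (c : R) :
  (forall N : nat, exists n E : nat,
    [/\ (N <= n)%N, critG k n E & 2 * c * n%:R ^+ 2 < E%:R]) ->
  density_set R 3 k.+1 c.
Proof.
move=> h N; have [n [E [Nn cE lt]]] := h N.
have [G [Gn crit girth le]] := critG_graph cE.
exists G; rewrite Gn; do 3!split=> //.
move: le; rewrite -(ler_nat R) -muln2 natrM; lra.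
Qed.

Lemma exists_large_nat (R : realType) (x : R) (N : nat) :
  exists m : nat, (N <= m)%N /\ x < m%:R.
Proof.
exists (maxn N (Num.truncn x).+1); split; first exact: leq_maxl.
apply: lt_le_trans (truncnS_gt x) _; rewrite ler_nat; exact: leq_maxr.
Qed.

Lemma density_set4 (R : realType) (c : R) : c < 1 / 16 -> density_set R 3 4 c.
Proof.
move=> c16; apply: density_set_crit => N.
exists (4 * N.+2.*2.+1)%N, (2 * (N.+2.*2.+1 * N.+2.*2.+1))%N.
split; [lia|exact: critG_toft|].
rewrite !natrM; set r : R := N.+2.*2.+1%:R.
have r0 : 0 < r by rewrite ltr0n.
have : 0 < (1 / 16 - c) * r ^+ 2 by rewrite mulr_gt0 ?subr_gt0 ?exprn_gt0.
nra.
Qed.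

Lemma density_set5 (R : realType) (c : R) : c < 4 / 31 -> density_set R 3 5 c.
Proof.
move=> c31; apply: density_set_crit => N.
have [m [Nm xm]] := exists_large_nat (4 / 31 - c)^-1 N.+2.
have m2 : (2 <= m)%N by lia.
set n := m.*2.+1.
exists (124 * (n * n) + 19 * n + 8)%N, (3968 * (n * n * (n * n)))%N.
split; [by rewrite /n; nia|exact: critG_dense5 m2|].
rewrite /n.
have um : m%:R <= m.*2.+1%:R :> R by rewrite ler_nat; lia.
rewrite !natrD !natrM; set u : R := m.*2.+1%:R in um *.
set d : R := 4 / 31 - c in xm.
have d0 : 0 < d by rewrite subr_gt0.
have u1 : 1 <= u by rewrite (ler_nat _ 1).
have du : 1 < d * u.
  by rewrite -(mulfV (lt0r_neq0 d0)) ltr_pM2l //; apply: lt_le_trans um.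
have -> : c = 4 / 31 - d by rewrite /d; ring.
have dl1 : 0 < d * u - 1 by lra.
have h1 : 0 <= u ^+ 3 * (d * u - 1) by rewrite mulr_ge0 ?exprn_ge0 //; lra.
have h2 : 0 <= d * u ^+ 3 by rewrite mulr_ge0 ?exprn_ge0 //; lra.
have h3 : 0 <= d * u ^+ 2 by rewrite mulr_ge0 ?exprn_ge0 //; lra.
have h4 : 0 <= d * u by lra.
have h5 : u ^+ 2 <= u ^+ 3 by rewrite ler_weXn2l.
have h6 : u <= u ^+ 2 by rewrite expr2 ler_peMr //; lra.
(* As [3968 = 8/31 * 124^2], the [u^4] terms free of [d] cancel; by [d * u > 1], the remaining
   [d * u^4] outweighs all lower terms. *)
suff : 0 < 3968 * (u * u * (u * u)) - 2 * (4 / 31 - d) * (124 * (u * u) + 19 * u + 8) ^+ 2 by lra.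
have -> : 3968 * (u * u * (u * u)) - 2 * (4 / 31 - d) * (124 * (u * u) + 19 * u + 8) ^+ 2 =
  2 * d * (15376 * u ^+ 4 + 4712 * u ^+ 3 + 2345 * u ^+ 2 + 304 * u + 64)
   - 8 / 31 * (4712 * u ^+ 3 + 2345 * u ^+ 2 + 304 * u + 64) by field.
lra.
Qed.

Lemma density_set6 (R : realType) (k : nat) (c : R) : (6 <= k)%N -> c < 1 / 4 ->
  density_set R 3 k c.
Proof.
case: k => // k k6 c4; apply: density_set_crit => M.
have [N [MN xN]] := exists_large_nat (4 * (1 / 4 - c)^-1) M.+2.
have k5 : (5 <= k)%N by lia.
have N2 : (2 <= N)%N by lia.
have [n [p [E [crit /andP [Np pn] nle le]]]] := critG_dense6 k5 (ltnW N2).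
exists n, E; split=> //; first by lia.
move: nle le; rewrite -!(ler_nat R) !natrM natrD natrM natrB ?(ltnW N2) //.
have : 2 <= N%:R :> R by rewrite (ler_nat _ 2).
have : 0 < p%:R :> R by rewrite ltr0n; lia.
have : 0 <= n%:R :> R by [].
move: xN; set d := 1 / 4 - c.
have d0 : 0 < d by rewrite subr_gt0.
have -> : c = 1 / 4 - d by rewrite /d; ring.
move: (N%:R) (p%:R) (n%:R) (E%:R) => y x z e yd z0 x0 y2 h1 h2.
have dy : 4 < d * y.
  have := yd; rewrite mulrC -ltr_pdivlMl ?invr_gt0 // invrK; lra.
have y0 : 0 < y by lra.
have hz : (y * z) ^+ 2 <= ((2 * y + 3) * x) ^+ 2.
  by rewrite ler_sqr ?nnegrE // mulr_ge0 //; lra.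
have x20 : 0 < x ^+ 2 by rewrite exprn_gt0.
(* The terms [2 * y^2] cancel; what is left against the claim is linear in [y], and
   [8 * d * y^2 > 32 * y] outweighs it. *)
have key : 2 * (1 / 4 - d) * (2 * y + 3) ^+ 2 < 2 * (y - 1) * y.
  suff : 0 < 2 * (y - 1) * y - 2 * (1 / 4 - d) * (2 * y + 3) ^+ 2 by lra.
  have : 0 <= (d * y - 4) * y by rewrite mulr_ge0 //; lra.
  nra.
(* For [c <= 0] signs suffice; for [c > 0] the bound on [n] may be multiplied by [c], and the
   inequalities [a1], [a2], [a3] chain up. *)
have [dle|dgt] := lerP (1 / 4 - d) 0.
  apply: (@le_lt_trans _ _ 0); first by rewrite mulr_le0_ge0 ?exprn_ge0 //; lra.
  rewrite -(pmulr_rgt0 _ y0); apply: lt_le_trans h2.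
  by rewrite !mulr_gt0 //; lra.
have a1 : 2 * (1 / 4 - d) * (y * z) ^+ 2 <= 2 * (1 / 4 - d) * ((2 * y + 3) * x) ^+ 2.
  by rewrite ler_wpM2l //; lra.
have a2 : 2 * (1 / 4 - d) * (2 * y + 3) ^+ 2 * x ^+ 2 < 2 * (y - 1) * y * x ^+ 2.
  by rewrite ltr_pM2r.
have a3 : y * (2 * (y - 1) * (x * x)) <= y * (y * e) by rewrite ler_pM2l.
have y20 : 0 < y ^+ 2 by rewrite exprn_gt0.
rewrite -(ltr_pM2l y20); lra.
Qed.

(** If the supremum were below [g], the midpoint would be an element above it. Mantel's bound
    ensures that [sup] is a true supremum and not a default value. *)
Lemma density_const_ge (R : realType) (k : nat) (g : R) :
  (forall c, c < g -> density_set R 3 k c) -> g <= density_const R 3 k.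
Proof.
move=> dense; rewrite leNgt; apply/negP => lt.
have mid_set : density_set R 3 k ((density_const R 3 k + g) / 2) by apply: dense; lra.
have ub : has_ubound (density_set R 3 k) by exists (1 / 4); apply: density_set_ub.
have := ub_le_sup ub mid_set; rewrite -/(density_const R 3 k); lra.
Qed.

Lemma density_const_eq (R : realType) (k : nat) : (6 <= k)%N ->
  density_const R 3 k = 1 / 4.
Proof.
move=> k6; apply: le_anti; apply/andP; split; last first.
  by apply: density_const_ge => c; apply: density_set6.
apply: ge_sup; last exact: density_set_ub.
by exists 0; apply: density_set6 => //; lra.
Qed.

Close Scope ring_scope.
Unset Implicit Arguments.

Theorem theorem1 (R : realType) :
  (exists c : R, (0 < c)%R /\
     exists F : graph -> Prop,
       (forall G, F G -> triangle_free G /\ critical G /\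
                         (c * ((gn G)%:R ^+ 2) < (nedges G)%:R)%R) /\
       (forall k, (4 <= k)%N -> forall N : nat,
          exists G, F G /\ (N <= gn G)%N /\ chromatic_eq G k)) /\
  (1 / 16 <= density_const R 3 4)%R /\
  (4 / 31 <= density_const R 3 5)%R /\
  (forall k, (6 <= k)%N -> density_const R 3 k = 1 / 4)%R.
Proof.
split; last split; last split.
(* Any positive constant below 1/16, the least of the three density bounds, would do for all [k] at
   once. *)
- exists (1 / 32)%R; split; first by lra.
  exists (fun G => triangle_free G /\ critical G /\
    (1 / 32 * ((gn G)%:R ^+ 2) < (nedges G)%:R :> R)%R).
  split=> // k k4 N.
  have dense : density_set R 3 k (1 / 32)%R.
    have [->|k4'] := eqVneq k 4; first by apply: density_set4; lra.
    have [->|k5] := eqVneq k 5; first by apply: density_set5; lra.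
    by apply: density_set6; [lia|lra].
  have [G [NG [crit [girth edges]]]] := dense N.
  exists G; split; last by split=> //; case: crit.
  by do 2!split=> //; exists k.
- by apply: density_const_ge => c; apply: density_set4.
- by apply: density_const_ge => c; apply: density_set5.
- by move=> k; apply: density_const_eq.
Qed.
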